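(* Let $d\in\mathbb N$ and let $K\subseteq\mathbb R^d$ be a compact set for which there is $\epsilon>0$ such that for every (affine) line $L\subseteq\mathbb R^d$, the set $K\cap L$ is $\epsilon$-porous relative to $L$. Then there exists $C>0$ such that for every $\mathbf x\in K\setminus\mathbb Q^d$ there are infinitely many $\mathbf p/q\in\mathbb Q^d\setminus K$ ($\mathbf p\in\mathbb Z^d$, $q\in\mathbb N$) satisfying \[ \left\|\mathbf x-\frac{\mathbf p}{q}\right\|\le\frac{C}{q^{1+1/d}}. \]
   Context: $\|\cdot\|$ denotes the max norm. For $\epsilon>0$, a subset $S$ of a metric space $X$ is $\epsilon$-porous relative to $X$ if for every ball $B(x,r)\subseteq X$ there is a ball $B(y,\epsilon r)\subseteq B(x,r)$ which is disjoint from $S$. *)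

(* Defs.v *)
From HB Require Import structures.
From mathcomp Require Import all_boot all_order all_algebra.
From mathcomp Require Import all_classical all_reals all_analysis.

Set Implicit Arguments.
Unset Strict Implicit.
Unset Printing Implicit Defensive.

Import Order.TTheory GRing.Theory Num.Theory.
Import numFieldNormedType.Exports.

Local Open Scope classical_set_scope.
Local Open Scope ring_scope.

(* [X] carries the metric induced by [M], so its balls are the traces on [X]
   of the (open) balls of [M] centred at points of [X]. *)
Definition porous {R : realType} {M : pseudoMetricType R}
    (eps : R) (S X : set M) : Prop :=
  S `<=` X /\
  forall (x : M) (r : R), X x -> 0 < r ->
    exists2 y : M, X y &
      X `&` ball y (eps * r) `<=` X `&` ball x r /\
      (X `&` ball y (eps * r)) `&` S = set0.

Definition affine_line {R : realType} {d : nat} (L : set 'rV[R]_d) : Prop :=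
  exists a v : 'rV[R]_d, v != 0 /\ L = range (fun t : R => a + t *: v).

Definition rational_points (R : realType) (d : nat) : set 'rV[R]_d :=
  range (fun r : 'rV[rat]_d => map_mx ratr r).
Arguments rational_points : clear implicits.

Definition vec_frac {R : realType} {d : nat} (p : 'rV[int]_d) (q : nat) :
  'rV[R]_d := (q%:R)^-1 *: map_mx intr p.

(* Main.v *)
(* Let p/q and p'/q' be consecutive best approximations of x.  Every mediant
   (a p + N p') / (a q + N q') with 0 <= a <= N has denominator at most 2 N q'
   and lies at distance O(N q'^(-1/d)) / (a q + N q') from x, so it satisfies
   the required inequality with a constant depending only on N.  These mediants
   lie on the rational line through p/q and p'/q'.  They fill a segment, with
   gaps at most 2/N times its length, so by porosity of K on that line one of
   them falls into a hole of K as soon as N > 2/eps. *)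

Require Import Defs.
From HB Require Import structures.
From mathcomp Require Import all_boot all_order all_algebra.
From mathcomp Require Import all_classical all_reals all_analysis.
From mathcomp Require Import ring lra.

Set Implicit Arguments.
Unset Strict Implicit.
Unset Printing Implicit Defensive.

Import Order.TTheory GRing.Theory Num.Theory.
Import numFieldNormedType.Exports.

Local Open Scope classical_set_scope.
Local Open Scope ring_scope.

(** * Max norm and distance to the integer lattice *)

Lemma rV_norm_le (R : realType) d (v : 'rV[R]_d) (e : R) :
  0 <= e -> (forall i, `|v 0 i| <= e) -> `|v| <= e.
Proof.
move=> e0 ve; rewrite [leLHS]/Num.norm /= mx_normrE; apply: bigmax_le => //.
by move=> [i j] _ /=; rewrite ord1.
Qed.

Lemma rV_coord_le_norm (R : realType) d (v : 'rV[R]_d) i : `|v 0 i| <= `|v|.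
Proof.
rewrite [leRHS]/Num.norm /= mx_normrE.
exact: (le_bigmax _ (fun ij : 'I_1 * 'I_d => `|v ij.1 ij.2|) (0, i)).
Qed.

Lemma round_dist_le (R : realType) (t : R) (k : int) :
  `|t - (Num.floor (t + 2^-1))%:~R| <= `|t - k%:~R|.
Proof.
have /andP[] := floor_itv (t + 2^-1).
move: (Num.floor _) => m; rewrite intrD => h1 h2.
have [km|mk|->//] := ltgtP k m.
- have : (k + 1)%:~R <= m%:~R :> R by rewrite ler_int lezD1.
  rewrite intrD => h3; rewrite (ger0_norm (_ : 0 <= t - k%:~R)); last by lra.
  by rewrite ler_norml; apply/andP; split; lra.
- have : (m + 1)%:~R <= k%:~R :> R by rewrite ler_int lezD1.
  rewrite intrD => h3; rewrite (ler0_norm (_ : t - k%:~R <= 0)); last by lra.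
  by rewrite ler_norml; apply/andP; split; lra.
Qed.

Definition nearest_int (R : realType) d (y : 'rV[R]_d) : 'rV[int]_d :=
  \row_i Num.floor (y 0 i + 2^-1).

Definition lattice_dist (R : realType) d (y : 'rV[R]_d) : R :=
  `|y - map_mx intr (nearest_int y)|.

(** In the max norm, rounding each coordinate separately is optimal, so [lattice_dist] is the true
    distance to the integer lattice and any integer vector bounds it from above. *)
Lemma lattice_dist_le (R : realType) d (y : 'rV[R]_d) (p : 'rV[int]_d) :
  lattice_dist y <= `|y - map_mx intr p|.
Proof.
apply: rV_norm_le => // i; apply: le_trans (rV_coord_le_norm _ i).
by rewrite !mxE round_dist_le.
Qed.

(** * Dirichlet's theorem and best approximations *)

(** Pigeonhole: the fractional parts of [k x] for [0 <= k <= n ^ d] fall into [n ^ d] cubes of side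
    [1/n]; two multipliers sharing a cube differ by the wanted [q]. *)
Lemma dirichlet (R : realType) d (x : 'rV[R]_d) (n : nat) : (0 < n)%N ->
  exists2 q : nat, (0 < q <= n ^ d)%N & lattice_dist (q%:R *: x) <= n%:R^-1.
Proof.
case: n => // n _.
pose fr (k : nat) (i : 'I_d) : R := k%:R * x 0 i - (Num.floor (k%:R * x 0 i))%:~R.
have fr_itv k i : 0 <= fr k i < 1.
  have := floor_itv (k%:R * x 0 i); rewrite intrD /fr => /andP[h1 h2].
  by apply/andP; split; lra.
(* [inord] would send an index out of range to 0; [trunc_fr] rules this out. *)
pose cell (k : 'I_(n.+1 ^ d).+1) : {ffun 'I_d -> 'I_n.+1} :=
  [ffun i => inord (Num.truncn (n.+1%:R * fr k i))].
have /injectivePn[k0 [l0 kl cell_kl]] : ~~ injectiveb cell.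
  apply/negP => /injectiveP /leq_card.
  by rewrite card_ffun !card_ord ltnn.
wlog {kl}: k0 l0 cell_kl / (k0 < l0)%N.
  move=> wl; case: (ltngtP k0 l0) => h; [exact: wl cell_kl h|exact: wl (esym cell_kl) h|].
  by move: kl; rewrite (val_inj h) eqxx.
have lt_l0 := ltn_ord l0; move=> kl.
exists (l0 - k0)%N; first by rewrite subn_gt0 kl /= (leq_trans (leq_subr _ _)).
(* With this [p] the error vector is the difference of two fractional parts from the same cube. *)
pose p : 'rV[int]_d :=
  \row_i (Num.floor (l0%:R * x 0 i) - Num.floor (k0%:R * x 0 i)).
apply: le_trans (lattice_dist_le _ p) _; apply: rV_norm_le => // i.
have -> : ((l0 - k0)%:R *: x - map_mx intr p) 0 i = fr l0 i - fr k0 i.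
  by rewrite !mxE natrB ?(ltnW kl)// intrB /fr; ring.
have := congr1 (fun f : {ffun 'I_d -> 'I_n.+1} => nat_of_ord (f i)) cell_kl.
have trunc_fr k : (Num.truncn (n.+1%:R * fr k i) < n.+1)%N.
  have /andP[h0 h1] := fr_itv k i.
  by rewrite truncn_lt_nat ?mulr_ge0// gtr_pMr ?ltr0n.
rewrite !ffunE !inordK//.
have /andP[hk _] := fr_itv k0 i; have /andP[hl _] := fr_itv l0 i.
have /andP[] := truncn_itv (mulr_ge0 (ler0n R n.+1) hk).
have /andP[] := truncn_itv (mulr_ge0 (ler0n R n.+1) hl).
move=> + + + + eq_trunc; rewrite eq_trunc -[(Num.truncn _).+1]addn1 natrD => hl1 hl2 hk1 hk2.
have n0 : 0 < n.+1%:R :> R by rewrite ltr0n.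
rewrite -(ler_pM2l n0) -(ger0_norm (ltW n0)) -normrM mulrBr (ger0_norm (ltW n0)).
by rewrite divff ?gt_eqF// ler_norml; apply/andP; split; lra.
Qed.

Lemma rational_vec_frac (R : realType) d (p : 'rV[int]_d) (q : nat) :
  rational_points R d (vec_frac p q).
Proof.
exists (\row_i (q%:R^-1 * (p 0 i)%:~R)) => //.
by apply/rowP => i; rewrite !mxE rmorphM /= fmorphV rmorph_nat ratr_int.
Qed.

Lemma lattice_dist_gt0 (R : realType) d (x : 'rV[R]_d) (q : nat) :
  ~ rational_points R d x -> (0 < q)%N -> 0 < lattice_dist (q%:R *: x).
Proof.
move=> irr q0; rewrite lt_def normr_ge0 andbT; apply: contra_notN irr.
rewrite normr_eq0 subr_eq0 => /eqP qx.
have -> : x = vec_frac (nearest_int (q%:R *: x)) q.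
  by rewrite /vec_frac -qx scalerA mulVf ?scale1r// pnatr_eq0 -lt0n.
exact: rational_vec_frac.
Qed.

Lemma lt_inv_nat (R : realType) (e : R) : 0 < e ->
  exists2 n : nat, (0 < n)%N & n%:R^-1 < e.
Proof.
move=> e0; exists (Num.truncn e^-1).+1 => //.
by rewrite -[ltRHS]invrK ltf_pV2 ?posrE ?invr_gt0 ?ltr0n// truncnS_gt.
Qed.

(* q minimizes the distance up to T, and q' is the first denominator that beats
   it; Dirichlet's theorem with n^d < q' then bounds the distance at q. *)
Lemma consecutive_approximations (R : realType) d (x : 'rV[R]_d) (T : nat) :
  (0 < d)%N -> ~ rational_points R d x -> (0 < T)%N ->
  exists q q' n : nat,
    [/\ (0 < q < q')%N, (0 < n)%N, (q' <= n.+1 ^ d)%N &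
        [/\ lattice_dist (q'%:R *: x) < lattice_dist (q%:R *: x),
            lattice_dist (q%:R *: x) <= n%:R^-1 &
            forall k : nat, (0 < k <= T)%N ->
              lattice_dist (q%:R *: x) <= lattice_dist (k%:R *: x)]].
Proof.
move=> d0 irr; case: T => // T _.
pose ld (k : nat) := lattice_dist (k%:R *: x).
have [j _ jmin] := arg_minP (fun j : 'I_T.+1 => ld j.+1) (erefl : xpredT (ord0 : 'I_T.+1)).
have qmin k : (0 < k <= T.+1)%N -> ld j.+1 <= ld k.
  by case: k => // k kT; exact: (jmin (Ordinal kT)).
have [n n0 nj] := lt_inv_nat (lattice_dist_gt0 irr (ltn0Sn j)).
have [k /andP[k0 _] kn] := dirichlet x n0.
have ex_k : exists k, (0 < k)%N && (ld k < ld j.+1).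
  by exists k; rewrite k0 (le_lt_trans kn).
case: (ex_minnP ex_k) => q' /andP[q'0 q'j] q'min.
have jq' : (j.+1 < q')%N.
  apply: (leq_ltn_trans (ltn_ord j)); rewrite ltnNge; apply: contraL q'j => q'T.
  by rewrite -leNgt qmin// q'0.
have ex_m : exists m, (q' <= m ^ d)%N.
  by exists q'; rewrite -{1}(expn1 q') leq_pexp2l.
(* The least base is at least 2 since [1 < q'], so [n = m.+1] is positive, and its minimality gives
   [n ^ d < q']. *)
case: (ex_minnP ex_m) => -[|[|m]].
- by rewrite exp0n// leqNgt q'0.
- by rewrite exp1n leqNgt (leq_ltn_trans _ jq').
move=> q'm mmin; exists j.+1, q', m.+1; split=> //; split=> //.
have [l /andP[l0 ln] lm] := dirichlet x (ltn0Sn m).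
apply: le_trans lm; rewrite leNgt; apply/negP => lj.
have q'l : (q' <= l)%N by rewrite q'min// l0.
by have := mmin _ (leq_trans q'l ln); rewrite ltnn.
Qed.

(** * Holes on a line and the spacing of mediants *)

Lemma porous_line_hole (R : realType) d (K : set 'rV[R]_d) (eps tau : R)
    (a v : 'rV[R]_d) :
  v != 0 -> 0 < eps -> 0 < tau ->
  porous eps (K `&` range (fun t : R => a + t *: v))
    (range (fun t : R => a + t *: v)) ->
  exists s : R, [/\ eps * (tau / 2) <= s, s < tau &
    forall t : R, `|t - s| < eps * (tau / 2) -> ~ K (a + t *: v)].
Proof.
move=> v0 eps0 tau0 [_ por].
have nv0 : 0 < `|v| by rewrite normr_gt0.
have ballE t s r : ball (a + t *: v) (r * `|v|) (a + s *: v) = (`|t - s| < r) :> Prop.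
  rewrite -ball_normE /ball_ /= opprD addrACA subrr add0r -scalerBl normrZ.
  by rewrite ltr_pM2r.
have r0 : 0 < tau / 2 * `|v| by rewrite mulr_gt0 ?divr_gt0.
(* The parametrization scales distances by [|v|], so this ball is the open segment of parameters
   between 0 and [tau]. *)
have [_ [s _ <-] [sub disj]] := por _ _ (imageT _ (tau / 2)) r0.
rewrite mulrA in sub disj.
have sub_itv t : `|s - t| < eps * (tau / 2) -> 0 < t < tau.
  move=> st; have [|_] := sub (a + t *: v); first by split; [exists t|rewrite ballE].
  by rewrite ballE ltr_norml => /andP[h1 h2]; apply/andP; split; lra.
have h0 : 0 < eps * (tau / 2) by rewrite mulr_gt0 ?divr_gt0.
have /andP[s0 stau] : 0 < s < tau by apply: sub_itv; rewrite subrr normr0.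
exists s; split => //.
(* A smaller [s] would put the parameter 0 into the hole, yet 0 is outside the open segment. *)
- rewrite leNgt; apply/negP => hs.
  by have := sub_itv 0; rewrite subr0 gtr0_norm// ltxx => /(_ hs).
- move=> t ts Kt; suff : (set0 : set 'rV[R]_d) (a + t *: v) by [].
  by rewrite -disj; split; [split; [exists t|rewrite ballE distrC]|split; [|exists t]].
Qed.

(** The mediant parameters climb from 0 at [a = 0] to [tau] at [a = N] in steps shorter than the
    hole, so the first one beyond the hole's left end cannot jump over it. *)
Lemma mediant_hits_hole (R : realType) (q q' N : nat) (eps tau s : R) :
  (0 < q < q')%N -> (0 < N)%N -> 0 < eps -> 2 < eps * N%:R ->
  tau = q%:R / (q%:R + q'%:R) ->
  eps * (tau / 2) <= s -> s < tau ->
  exists2 a : nat, (a <= N)%N &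
    `|a%:R * q%:R / (a%:R * q%:R + N%:R * q'%:R) - s| < eps * (tau / 2).
Proof.
move=> /andP[q0 qq'] N0 eps0 epsN tauE.
have [h hE] : exists h, h = eps * (tau / 2) by eexists.
rewrite -hE => hs stau.
pose t (a : nat) : R := a%:R * q%:R / (a%:R * q%:R + N%:R * q'%:R).
have q0R : 0 < q%:R :> R by rewrite ltr0n.
have q'0R : 0 < q'%:R :> R by rewrite ltr0n (ltn_trans q0).
have N0R : 0 < N%:R :> R by rewrite ltr0n.
have Nq' : 0 < N%:R * q'%:R :> R by rewrite mulr_gt0.
have den a : 0 < a%:R * q%:R + N%:R * q'%:R :> R.
  by rewrite ltr_wpDl// mulr_ge0.
have tau0 : 0 < tau by rewrite tauE divr_gt0 ?addr_gt0.
have h0 : 0 < h by rewrite hE; apply: mulr_gt0 => //; exact: divr_gt0.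
have tN : t N = tau.
  by rewrite /t tauE -mulrDr -mulf_div divff ?mul1r// gt_eqF.
have ex_a : exists a, s - h < t a by exists N; rewrite tN; lra.
(* [a = 0] is excluded because the hole starts at or after 0, which is the use of
   [eps * (tau / 2) <= s]. *)
case: (ex_minnP ex_a) => -[|a] lo amin.
  by move: lo; rewrite /t !mul0r; lra.
have aN : (a.+1 <= N)%N by apply: amin; rewrite tN; lra.
exists a.+1 => //; rewrite -/(t _).
have ta : t a <= s - h.
  by rewrite leNgt; apply/negP => /amin; rewrite ltnn.
have tau_ge : q%:R / (2 * q'%:R) <= tau.
  rewrite tauE ler_pM2l// lef_pV2 ?posrE ?addr_gt0 ?mulr_gt0//.
  by rewrite mulr_natl mulr2n lerD2r ler_nat ltnW.
have gap : t a.+1 - t a <= q%:R / (N%:R * q'%:R).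
  (* The first factor is at most [q / (N q')] and the second at most 1. *)
  have -> : t a.+1 - t a = q%:R / (a.+1%:R * q%:R + N%:R * q'%:R) *
      (N%:R * q'%:R / (a%:R * q%:R + N%:R * q'%:R)).
    rewrite /t -addn1 natrD; field.
    have := den a; have := den a.+1; rewrite -addn1 natrD => d1 d2.
    by rewrite !gt_eqF.
  rewrite -[leRHS]mulr1; apply: ler_pM.
  + by rewrite divr_ge0// ltW.
  + by rewrite divr_ge0// ltW.
  + by rewrite ler_pM2l// lef_pV2 ?posrE// lerDr mulr_ge0.
  + by rewrite ler_pdivrMr// mul1r lerDr mulr_ge0.
(* Since [q < q'] gives [q / (2 q') <= tau], the gap is at most [(2 / N) tau], which is below
   [eps * tau], the length of the hole. *)
have gap_h : q%:R / (N%:R * q'%:R) < 2 * h.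
  have -> : q%:R / (N%:R * q'%:R) = 2 / N%:R * (q%:R / (2 * q'%:R)) :> R.
    by field; rewrite !gt_eqF.
  have -> : 2 * h = eps * tau by rewrite hE; field.
  apply: le_lt_trans (_ : 2 / N%:R * tau < _).
    by rewrite ler_pM2l// divr_gt0.
  by rewrite ltr_pM2r// ltr_pdivrMr.
by rewrite ltr_norml; apply/andP; split; lra.
Qed.

(** * Infinitely many approximations with exponent 1 + 1/d *)

Lemma root_le (R : realType) d (Q m : nat) :
  (0 < d)%N -> (Q <= m ^ d)%N -> Q%:R `^ (d%:R^-1) <= m%:R :> R.
Proof.
move=> d0 Qm; have d0R : d%:R != 0 :> R by rewrite pnatr_eq0 -lt0n.
have -> : m%:R = (m ^ d)%:R `^ (d%:R^-1) :> R.
  by rewrite natrX -powR_mulrn// -powRrM divff// powRr1.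
by rewrite ge0_ler_powR ?invr_ge0 ?nnegrE// ler_nat.
Qed.

(** A finite set is closed, so its complement would be a neighbourhood of [x]. This reduces
    infinitude to finding one approximation within each [e]. *)
Lemma infinite_set_approachable (R : numFieldType) (V : normedModType R)
    (x : V) (A : set V) : ~ A x ->
  (forall e : R, 0 < e -> exists2 y, A y & `|x - y| < e) -> infinite_set A.
Proof.
move=> nAx approx finA.
have clA : closed A.
  apply: (iffLR accessible_finite_set_closed _ _ finA).
  exact/hausdorff_accessible/norm_hausdorff.
have /nbhs_ballP[e /= e0 xe] : nbhs x (~` A).
  by apply: open_nbhs_nbhs; split => //; exact: closed_openC.
have [y Ay xy] := approx e e0.
by apply: (xe y) => //; rewrite -ball_normE.
Qed.

Theorem theorem1p3 (R : realType) (d : nat) (d_gt0 : (0 < d)%N)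
    (K : set 'rV[R]_d) (cptK : compact K)
    (porK : exists2 eps : R, 0 < eps &
       forall L : set 'rV[R]_d, affine_line L -> porous eps (K `&` L) L) :
  exists2 C : R, 0 < C &
    forall x : 'rV[R]_d, (K `\` rational_points R d) x ->
      infinite_set [set y : 'rV[R]_d |
        (rational_points R d `\` K) y /\
        exists (p : 'rV[int]_d) (q : nat),
          [/\ (0 < q)%N, y = vec_frac p q &
              `|x - y| <= C / (q%:R `^ (1 + d%:R^-1))]].
Proof.
have [eps eps0 por] := porK.
have [N N0 Neps] : exists2 N : nat, (0 < N)%N & 2 < eps * N%:R.
  have [N N0 hN] := lt_inv_nat (divr_gt0 eps0 (ltr0n R 2)).
  exists N => //; move: hN; rewrite ltr_pdivlMr// mulrC.
  by rewrite -ltr_pdivlMr ?invr_gt0 ?ltr0n// invrK.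
have N0R : 0 < N%:R :> R by rewrite ltr0n.
(* The constant is the product of three bounds: [2 N] from [Qdist], [2 N] from [Qn], and 2 from
   [dn]. *)
exists (8 * N%:R ^+ 2); first by rewrite mulr_gt0// exprn_gt0.
move=> x [_ irr]; apply: (infinite_set_approachable (x := x)) => [[[]//]|e e0].
(* Minimizing over denominators up to [T ^ d] makes the distance at [q] at most [1/T], hence below
   [e / (2 N)]. *)
have [T T0 Te] := lt_inv_nat (divr_gt0 e0 (mulr_gt0 (ltr0n R 2) N0R)).
have Td0 : (0 < T ^ d)%N by rewrite expn_gt0 T0.
have [q [q' [n [qq' n0 q'n [lt_dist dist_n dist_min]]]]] :=
  consecutive_approximations d_gt0 irr Td0.
have [k kT kd] := dirichlet x T0.
have {kT kd} dist_e := le_lt_trans (le_trans (dist_min k kT) kd) Te.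
rewrite ltr_pdivlMr ?mulr_gt0// in dist_e.
have /andP[q0 lt_qq'] := qq'; have q'0 := ltn_trans q0 lt_qq'.
set p := nearest_int (q%:R *: x); set p' := nearest_int (q'%:R *: x).
pose u : 'rV[R]_d := map_mx intr p; pose u' : 'rV[R]_d := map_mx intr p'.
have dE : lattice_dist (q%:R *: x) = `|q%:R *: x - u| by [].
have d'E : lattice_dist (q'%:R *: x) = `|q'%:R *: x - u'| by [].
have q0R : 0 < q%:R :> R by rewrite ltr0n.
have q'0R : 0 < q'%:R :> R by rewrite ltr0n.
pose v : 'rV[R]_d := vec_frac p q - vec_frac p' q'.
have v0 : v != 0.
  (* If the two fractions coincided, the lattice distances would be [q] and [q'] times the same
     number, contradicting their strict decrease. *)
  apply/eqP => /subr0_eq Peq.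
  have uE : u = q%:R *: vec_frac p q by rewrite scalerA divff ?scale1r// gt_eqF.
  have u'E : u' = q'%:R *: vec_frac p q.
    by rewrite Peq scalerA divff ?scale1r// gt_eqF.
  move: lt_dist; rewrite dE d'E uE u'E -!scalerBr !normrZ !gtr0_norm// ltNge.
  by rewrite ler_wpM2r// ler_nat ltnW.
pose L := range (fun t : R => vec_frac p' q' + t *: v).
(* Parameter 0 is [p'/q'], and this one is the mediant [(p + p') / (q + q')], reached at [a = N]. *)
have tau0 : 0 < q%:R / (q%:R + q'%:R) :> R by rewrite divr_gt0 ?addr_gt0.
have [s [hs stau hole]] := porous_line_hole v0 eps0 tau0
  (por L (ex_intro _ _ (ex_intro _ v (conj v0 erefl)))).
have [a aN /hole nKy] := mediant_hits_hole qq' N0 eps0 Neps erefl hs stau.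
pose Q := (a * q + N * q')%N; pose P := a%:Z *: p + N%:Z *: p'.
have Q0 : (0 < Q)%N by rewrite addn_gt0 !muln_gt0 N0 q'0 orbT.
have Q0R : 0 < Q%:R :> R by rewrite ltr0n.
have QE : Q%:R = a%:R * q%:R + N%:R * q'%:R :> R by rewrite /Q natrD !natrM.
have yE : vec_frac P Q = vec_frac p' q' +
    (a%:R * q%:R / (a%:R * q%:R + N%:R * q'%:R)) *: v.
  rewrite -QE; apply/rowP => i; rewrite !mxE intrD !intrM -!pmulrn.
  move: (p 0 i) (p' 0 i) => b b'.
  move: QE Q0R q0R q'0R; move: (Q%:R) => Y -> h1 h2 h3.
  by field; rewrite !gt_eqF.
have aNR : a%:R <= N%:R :> R by rewrite ler_nat.
(* [Q x - P] is the combination of [q x - p] and [q' x - p'] with weights [a <= N] and [N], and both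
   errors are at most the one at [q]. *)
have Qdist : Q%:R * `|x - vec_frac P Q| <= 2 * N%:R * lattice_dist (q%:R *: x).
  have -> : Q%:R * `|x - vec_frac P Q| =
      `|a%:R *: (q%:R *: x - u) + N%:R *: (q'%:R *: x - u')|.
    rewrite -{1}(gtr0_norm Q0R) -normrZ scalerBr /vec_frac scalerA.
    rewrite divff ?gt_eqF// scale1r; congr (`| _ |).
    by apply/rowP => i; rewrite !mxE QE intrD !intrM -!pmulrn; ring.
  apply: le_trans (ler_normD _ _) _; rewrite !normrZ !ger0_norm// -dE -d'E.
  rewrite mulr2n mulrDl mul1r mulrDl lerD//.
    by rewrite ler_wpM2r// dE.
  by rewrite ler_pM2l// ltW.
have Q1 : 1 <= Q%:R :> R by rewrite ler1n.
exists (vec_frac P Q); last first.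
  apply: le_lt_trans dist_e; rewrite mulrC; apply: le_trans Qdist.
  by rewrite ler_peMl.
split; first by split; [exact: rational_vec_frac|rewrite yE].
exists P, Q; split => //.
(* [Q <= 2 N q'] and [q' <= n.+1 ^ d]; as [0 < d], the factor [2 N] may be raised to the power [d]
   as well. *)
have Qn : (Q <= (2 * N * n.+1) ^ d)%N.
  rewrite expnMn; apply: leq_trans (_ : 2 * N * q' <= _)%N.
    rewrite /Q mul2n -addnn mulnDl leq_add2r leq_mul// ltnW//.
  by rewrite leq_mul// -[leqLHS]expn1 leq_pexp2l// muln_gt0.
have rootQ := root_le R d_gt0 Qn.
rewrite powRD; last by rewrite gt_eqF ?implybT.
rewrite powRr1 ?ler0n// ler_pdivlMr; last by rewrite mulr_gt0 ?powR_gt0.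
rewrite mulrA [_ * Q%:R]mulrC.
apply: le_trans (ler_pM _ _ Qdist rootQ) _; rewrite ?mulr_ge0 ?powR_ge0//.
have n0R : 0 < n%:R :> R by rewrite ltr0n.
(* The loss between [n] and [n.+1] costs only a factor 2, because [0 < n]. *)
have dn : lattice_dist (q%:R *: x) * n.+1%:R <= 2.
  apply: le_trans (_ : n%:R^-1 * (2 * n%:R) <= _).
    apply: ler_pM => //; first exact: normr_ge0.
    by rewrite -natrM ler_nat mul2n -addnn -addn1 leq_add2l.
  by rewrite mulrCA mulVf ?mulr1// gt_eqF.
have N2 : 0 < 4 * N%:R ^+ 2 :> R by rewrite mulr_gt0 ?exprn_gt0.
have -> : 8 * N%:R ^+ 2 = 4 * N%:R ^+ 2 * 2 :> R by ring.
apply: le_trans (_ : _ <= 4 * N%:R ^+ 2 * (lattice_dist (q%:R *: x) * n.+1%:R)) _.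
  by rewrite !natrM le_eqVlt; apply/orP; left; apply/eqP; ring.
by rewrite ler_pM2l.
Qed.
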